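(* Let $A,B,C\in\mathbb{R}^{n\times n}$ satisfy Assumptions A4, A5, A6 (see context), let $\mathbf{u}>\mathbf{0}$ be a row vector with $\mathbf{u}(A-B+C)=\mathbf{0}$, and let $A_k,B_k,C_k,\hat B_k$ ($k\ge 0$) be the iterates of Cyclic Reduction started from $A,B,C$, with $\hat B_\infty=\lim_{k\to\infty}\hat B_k$. Then the following hold. (1) $(A_0-\hat B_k+C_k)\mathbf{1}=\mathbf{0}$ for each $k\ge 0$; hence the limit $\hat{\mathbf{w}}:=\lim_{k\to\infty}C_k\mathbf{1}$ exists, and $(\mathrm{offdiag}(\hat B_\infty),\ \mathbf{1},\ A_0\mathbf{1}+\hat{\mathbf{w}})$ is a triplet representation for $\hat B_\infty$. (2) $\mathbf{u}(A_k-B_k+C_k)=\mathbf{0}$ for each $k\ge 0$. (3) $\mathbf{u}(A_k-\hat B_k+C_0)=\mathbf{0}$ for each $k\ge 0$; hence the limit $\hat{\mathbf{v}}:=\lim_{k\to\infty}\mathbf{u}A_k$ exists, and $(\mathrm{offdiag}(\hat B_\infty^{\top}),\ \mathbf{u}^{\top},\ (\mathbf{u}C_0+\hat{\mathbf{v}})^{\top})$ is a triplet representation for $\hat B_\infty^{\top}$.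
   Context: Inequalities between matrices and vectors are componentwise; $\mathbf 1,\mathbf 0$ are the vectors of all ones and all zeros. $\mathrm{offdiag}(M)$ is the vector of the entries $M_{ij}$, $i\ne j$, of a square matrix $M$ in some fixed order. An M-matrix is a real square matrix $M=sI-P$ with $P\ge 0$, $s\geq 0$ and $s\ge\rho(P)$ (spectral radius). A triplet representation for an M-matrix $M\in\mathbb{R}^{n\times n}$ is a triple $(\mathbf m,\mathbf v,\mathbf w)$ with $\mathbf m=\mathrm{offdiag}(M)\le \mathbf 0$, $\mathbf v\in\mathbb{R}^n$, $\mathbf v>\mathbf 0$, $\mathbf w\in\mathbb{R}^n$, $\mathbf w\ge\mathbf 0$ and $M\mathbf v=\mathbf w$. Assumptions: (A4) $A\ge 0$, $C\ge 0$ and $B$ is an M-matrix. (A5) $(A-B+C)\mathbf 1=\mathbf 0$. (A6) The bi-infinite block tridiagonal matrix with every diagonal block equal to $-B$, every block on the first superdiagonal equal to $C$, and every block on the first subdiagonal equal to $A$, is irreducible and aperiodic (the directed graph of its nonzero entries is strongly connected and the gcd of the lengths of its closed walks is 1). Under these assumptions $A-B+C$ is irreducible and singular, and there is a row vector $\mathbf u\in\mathbb{R}^{1\times n}$, $\mathbf u>\mathbf 0$, unique up to scaling, with $\mathbf u(A-B+C)=\mathbf 0$. Cyclic Reduction: $A_0=A$, $B_0=\hat B_0=B$, $C_0=C$ and for $k=0,1,2,\dots$ $$A_{k+1}=A_kB_k^{-1}A_k,\quad B_{k+1}=B_k-A_kB_k^{-1}C_k-C_kB_k^{-1}A_k,\quad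 C_{k+1}=C_kB_k^{-1}C_k,\quad \hat B_{k+1}=\hat B_k-C_kB_k^{-1}A_k.$$ It is known that under A4, A5, A6 every $B_k$ is nonsingular, $A_k,C_k\ge 0$, $B_k$ and $\hat B_k$ are M-matrices, $(A_k-B_k+C_k)\mathbf 1=\mathbf 0$ for all $k\geq 0$, and $\hat B_k$ converges to an invertible matrix $\hat B_\infty$. *)

(* Defs.v *)
From HB Require Import structures.
From mathcomp Require Import all_boot all_order all_algebra.
From mathcomp Require Import all_classical all_reals all_analysis.
From mathcomp Require Import complex.

Set Implicit Arguments.
Unset Strict Implicit.
Unset Printing Implicit Defensive.

Import Order.TTheory GRing.Theory Num.Theory.
Import numFieldNormedType.Exports.

Local Open Scope classical_set_scope.
Local Open Scope ring_scope.

Definition offdiag_index (n : nat) : {pred 'I_n * 'I_n} :=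
  [pred p | p.1 != p.2].
Arguments offdiag_index : clear implicits.

Section Matrices.
Context {R : realType}.

Definition mx_le {m n : nat} (M N : 'M[R]_(m, n)) : Prop :=
  forall i j, M i j <= N i j.

Definition mx_lt {m n : nat} (M N : 'M[R]_(m, n)) : Prop :=
  forall i j, M i j < N i j.

(* Largest modulus of a complex eigenvalue. The set is finite, and nonempty
   when 0 < n; for n = 0 the value is sup set0 = 0. The norm on R[i] takes its
   values in R[i], hence the real part. *)
Definition spectral_radius {n : nat} (P : 'M[R]_n) : R :=
  sup [set complex.Re `|z| |
       z in [set z : R[i] | eigenvalue (map_mx (real_complex R) P) z]].

Definition M_matrix {n : nat} (M : 'M[R]_n) : Prop :=
  exists (s : R) (P : 'M[R]_n),
    [/\ M = s%:M - P, mx_le 0 P, 0 <= s & spectral_radius P <= s].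

(* The fixed order is that of the enumeration of offdiag_index n. *)
Definition offdiag {n : nat} (M : 'M[R]_n) : 'cV[R]_#|offdiag_index n| :=
  \col_k M (enum_val k).1 (enum_val k).2.

Definition triplet_representation {n : nat} (M : 'M[R]_n)
    (m : 'cV[R]_#|offdiag_index n|) (v w : 'cV[R]_n) : Prop :=
  M_matrix M /\
  [/\ m = offdiag M, mx_le m 0, mx_lt 0 v, mx_le 0 w & M *m v = w].

Definition bi_infinite {n : nat} (A B C : 'M[R]_n) (x y : int * 'I_n) : R :=
  if y.1 == x.1 then - B x.2 y.2
  else if y.1 == x.1 + 1 then C x.2 y.2
  else if y.1 == x.1 - 1 then A x.2 y.2
  else 0.

End Matrices.

(* A walk from x to y of length size p is given by the list p of its vertices
   after x. *)
Definition walk {T : Type} (e : rel T) (x y : T) (p : seq T) : Prop :=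
  path e x p /\ last x p = y.

Definition irreducible_graph {T : Type} (e : rel T) : Prop :=
  forall x y, exists p, walk e x y p.

(* gcd of a possibly infinite set of naturals, by its universal property. *)
Definition is_gcd (S : set nat) (g : nat) : Prop :=
  forall d, (d %| g)%N <-> (forall k, S k -> (d %| k)%N).

Definition closed_walk_lengths {T : Type} (e : rel T) : set nat :=
  [set k | exists x p, walk e x x p /\ size p = k].

Definition aperiodic_graph {T : Type} (e : rel T) : Prop :=
  is_gcd (closed_walk_lengths e) 1.

Definition nonzero_graph {R : realType} {T : Type} (M : T -> T -> R) : rel T :=
  fun x y => M x y != 0.

Section CyclicReduction.
Context {R : realType} {n : nat}.

Record cr_state := CRState {
  cr_A : 'M[R]_n; cr_B : 'M[R]_n; cr_C : 'M[R]_n; cr_Bhat : 'M[R]_n }.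

Definition cr_step (S : cr_state) : cr_state :=
  let: CRState A B C Bhat := S in
  CRState (A *m invmx B *m A)
          (B - A *m invmx B *m C - C *m invmx B *m A)
          (C *m invmx B *m C)
          (Bhat - C *m invmx B *m A).

Definition cyclic_reduction (A B C : 'M[R]_n) (k : nat) : cr_state :=
  iter k cr_step (CRState A B C B).

End CyclicReduction.

(* Main.v *)
Require Import Defs.
From mathcomp Require Import all_boot all_order all_algebra.
From mathcomp Require Import all_classical all_reals all_analysis.
From mathcomp Require Import complex ring lra zify.

Import Order.TTheory GRing.Theory Num.Theory.
Import numFieldNormedType.Exports.

Local Open Scope classical_set_scope.
Local Open Scope ring_scope.

(** The kernel identities are algebra once every [B_k] is invertible: if
    [(A_k + C_k) v = B_k v], then [B_k^-1] cancels in the combinations of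
    correction terms that occur, and each step of Cyclic Reduction adds zero to
    [(A_k - B_k + C_k) v] and to [(A_0 - Bhat_k + C_k) v], and likewise for left
    kernel vectors (lemmas [cr_ker_right], [cr_ker_left], [cr_hat_ker_right],
    [cr_hat_ker_left]).

    Invertibility of [B_k] is where irreducibility enters. A step of Cyclic
    Reduction eliminates the odd block rows, so a vector [x] with [B_k x = 0] can
    be filled in, level by level, to a vector [h] that vanishes outside
    [0 < j < 2^(k+1)], has [h_(2^k) = x], and satisfies
    [B h_j = A h_(j-1) + C h_(j+1)] inside. The bi-infinite matrix has zero row
    sums and nonnegative entries off the diagonal, so [h] obeys the maximum
    principle: a positive maximum spreads along the edges of the graph, and by
    irreducibility reaches a level where [h] is zero. Hence [h = 0] and [x = 0]
    ([dirichlet_eq0], [cr_B_unit]).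

    A nonsingular Z-matrix with nonnegative row sums has a nonnegative inverse
    ([Z_matrix_invmx_ge0]), so by induction [A_k, C_k >= 0] and [B_k] is a
    Z-matrix ([cr_signs]). Thus the entries of [Bhat_k] decrease, and
    [Bhat_k 1 >= 0] bounds them below, which gives convergence ([cr_Bhat_cvg]).
    The limits of [C_k 1] and [u A_k] follow from the kernel identities. Finally
    a Z-matrix [M] with [M v >= 0] for some [v > 0] is an M-matrix
    ([Z_matrix_M_matrix]); with [v = 1], and with [v = u^T] for the transpose,
    this gives both triplet representations. *)

(** * Nonnegative matrices and Z-matrices *)

Section ZMatrices.
Context {R : realType}.

Lemma mulmx_ge0 {m n p : nat} (M : 'M[R]_(m, n)) (N : 'M[R]_(n, p)) :
  mx_le 0 M -> mx_le 0 N -> mx_le 0 (M *m N).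
Proof.
move=> M0 N0 i j; rewrite !mxE; apply: sumr_ge0 => k _.
by apply: mulr_ge0; [have := M0 i k | have := N0 k j]; rewrite mxE.
Qed.

Lemma addmx_ge0 {m n : nat} (M N : 'M[R]_(m, n)) :
  mx_le 0 M -> mx_le 0 N -> mx_le 0 (M + N).
Proof.
move=> M0 N0 i j; have := M0 i j; have := N0 i j.
by rewrite !mxE => ? ?; apply: addr_ge0.
Qed.

Lemma trmx_ge0 {m n : nat} (M : 'M[R]_(m, n)) : mx_le 0 M -> mx_le 0 M^T.
Proof. by move=> M0 i j; have := M0 j i; rewrite !mxE. Qed.

Lemma const_mx_ge0 {m n : nat} (a : R) : 0 <= a ->
  mx_le 0 (const_mx a : 'M[R]_(m, n)).
Proof. by move=> a0 i j; rewrite !mxE. Qed.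

Definition Z_matrix {n : nat} (M : 'M[R]_n) : Prop :=
  forall i j, i != j -> M i j <= 0.

Lemma Z_matrix_tr {n : nat} (M : 'M[R]_n) : Z_matrix M -> Z_matrix M^T.
Proof. by move=> ZM i j ij; rewrite mxE ZM // eq_sym. Qed.

Lemma M_matrix_Z_matrix {n : nat} (M : 'M[R]_n) : M_matrix M -> Z_matrix M.
Proof.
move=> [s [P [-> P0 _ _]]] i j ij; rewrite !mxE (negbTE ij) mulr0n sub0r.
by have := P0 i j; rewrite mxE oppr_le0.
Qed.

Lemma offdiag_Z_matrix_le0 {n : nat} (M : 'M[R]_n) :
  Z_matrix M -> mx_le (offdiag M) 0.
Proof. by move=> ZM k j; rewrite !mxE; apply/ZM/(enum_valP k). Qed.

(** For an eigenvector [x P = z x] the triangle inequality gives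
    [|z| |x| <= |x| P] entrywise; pairing with [v] turns this into
    [|z| (|x| v) <= |x| P v <= s (|x| v)], where [|x| v > 0]. *)
Lemma spectral_radius_le {n : nat} (P : 'M[R]_n) (v : 'cV[R]_n) (s : R) :
  mx_le 0 P -> mx_lt 0 v -> 0 <= s -> mx_le (P *m v) (s *: v) ->
  spectral_radius P <= s.
Proof.
move=> P0 v0 s0 Pv; rewrite /spectral_radius.
set E := (X in sup X).
have [->|E0] := eqVneq E set0; first by rewrite sup0.
apply: ge_sup; first exact/set0P.
move=> _ [z /eigenvalueP [x xP x0] <-].
suff : `|z| <= s%:C%C by rewrite lecE /= => /andP[].
have v0' j : 0 < (v j 0)%:C%C :> R[i] by have := v0 j 0; rewrite mxE ltcR.
have xv0 : 0 < \sum_j `|x 0 j| * (v j 0)%:C%C.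
  have xv i : true -> 0 <= `|x 0 i| * (v i 0)%:C%C.
    by move=> _; rewrite mulr_ge0 // ltW.
  rewrite lt0r sumr_ge0 // andbT; apply: contra x0 => /eqP s_eq0.
  apply/eqP/rowP => j; rewrite mxE.
  have /eqP := psumr_eq0P xv s_eq0 (erefl : xpredT j).
  by rewrite mulf_eq0 (gt_eqF (v0' j)) orbF normr_eq0 => /eqP.
rewrite -(ler_pM2r xv0) mulr_sumr.
apply: (@le_trans _ _
    (\sum_j \sum_i `|x 0 i| * ((P i j)%:C%C * (v j 0)%:C%C))).
  apply: ler_sum => j _; rewrite mulrA -normrM.
  have := congr1 (fun y : 'rV_n => y 0 j) xP; rewrite !mxE => <-.
  under [leRHS]eq_bigr do rewrite mulrA.
  rewrite -mulr_suml ler_pM2r //; apply: le_trans (ler_norm_sum _ _ _) _.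
  apply: ler_sum => i _; rewrite mxE normrM ler_wpM2l // ger0_norm //.
  by have := P0 i j; rewrite mxE ler0c.
rewrite exchange_big /= mulr_sumr; apply: ler_sum => i _.
rewrite -mulr_sumr mulrCA ler_wpM2l //.
have := Pv i 0; rewrite !mxE -lecR rmorphM rmorph_sum.
by under eq_bigr do rewrite rmorphM.
Qed.

(** Any [s] dominating the diagonal makes [P = s I - M] nonnegative, and
    [P v = s v - M v <= s v] bounds its spectral radius. *)
Lemma Z_matrix_M_matrix {n : nat} (M : 'M[R]_n) (v : 'cV[R]_n) :
  Z_matrix M -> mx_lt 0 v -> mx_le 0 (M *m v) -> M_matrix M.
Proof.
move=> ZM v0 Mv; pose s := \sum_i `|M i i|.
have s0 : 0 <= s by apply: sumr_ge0.
have P0 : mx_le 0 (s%:M - M).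
  move=> i j; rewrite !mxE; have [<-|ij] := eqVneq i j.
    rewrite mulr1n subr_ge0 (le_trans (ler_norm _)) //.
    by rewrite /s (bigD1 i) //= lerDl sumr_ge0.
  by rewrite mulr0n sub0r oppr_ge0 ZM.
exists s, (s%:M - M); split => //; first by rewrite opprB addrC subrK.
apply: (spectral_radius_le _ v) => // i j.
by have := Mv i j; rewrite mulmxBl mul_scalar_mx !mxE gerBl.
Qed.

Lemma Z_matrix_triplet {n : nat} (M : 'M[R]_n) (v w : 'cV[R]_n) :
  Z_matrix M -> mx_lt 0 v -> mx_le 0 w -> M *m v = w ->
  triplet_representation M (offdiag M) v w.
Proof.
move=> ZM v0 w0 Mv; split; first by apply: (Z_matrix_M_matrix _ v); rewrite ?Mv.
by split => //; exact: offdiag_Z_matrix_le0.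
Qed.

(** At the index of a smallest entry [m] of [z], the row of [M z] is at most
    [m] times the row sum of [M], so [m <= 0] is impossible. *)
Lemma Z_matrix_mulmx_gt0 {n : nat} (M : 'M[R]_n) (z : 'cV[R]_n) :
  Z_matrix M -> mx_le 0 (M *m (const_mx 1 : 'cV[R]_n)) ->
  mx_lt 0 (M *m z) -> mx_lt 0 z.
Proof.
move=> ZM M1 Mz i j; rewrite ord1 mxE {j}.
case: (arg_minP (fun a => z a 0) (erefl : xpredT i)) => a _ amin.
rewrite (lt_le_trans _ (amin i isT)) // ltNge; apply/negP => za.
have := Mz a 0; rewrite !mxE ltNge => /negP; apply.
have := M1 a 0; rewrite !mxE => ra.
apply: (@le_trans _ _ ((\sum_b M a b * (const_mx 1 : 'cV[R]_n) b 0) * z a 0)).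
  rewrite mulr_suml; apply: ler_sum => b _; rewrite mxE mulr1.
  have [<- //|ab] := eqVneq a b.
  by rewrite ler_wnM2l ?ZM ?amin.
exact: mulr_ge0_le0.
Qed.

(** If [M y >= 0] then [M (y + d M^-1 1) > 0] for every [d > 0], hence
    [y + d M^-1 1 > 0]; letting [d] tend to [0] gives [y >= 0]. This is applied
    to the columns [y] of [M^-1]. *)
Lemma Z_matrix_invmx_ge0 {n : nat} (M : 'M[R]_n) :
  Z_matrix M -> mx_le 0 (M *m (const_mx 1 : 'cV[R]_n)) ->
  M \in unitmx -> mx_le 0 (invmx M).
Proof.
move=> ZM M1 uM i j; rewrite mxE.
have key (d : R) : 0 < d ->
    0 < invmx M i j + d * (invmx M *m (const_mx 1 : 'cV_n)) i 0.
  move=> d0.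
  pose z := col j (invmx M) + d *: (invmx M *m (const_mx 1 : 'cV_n)).
  suff /(_ i 0) : mx_lt 0 z by rewrite !mxE.
  apply: (Z_matrix_mulmx_gt0 M) => // a b.
  rewrite /z colE mulmxDr -scalemxAr !mulKVmx // !mxE mulr1.
  by rewrite ltr_wpDl.
rewrite leNgt; apply/negP => y0.
set g := (invmx M *m _) i 0 in key.
have [g0|g0] := lerP g 0.
  by have := key 1 ltr01; rewrite mul1r; lra.
have d0 : 0 < - invmx M i j / g by rewrite divr_gt0 // oppr_gt0.
by have := key _ d0; rewrite divfK ?gt_eqF // subrr ltxx.
Qed.

(** The row sum is nonnegative and its off-diagonal terms are nonpositive. *)
Lemma Z_matrix_lbound {n : nat} (M : 'M[R]_n) i j :
  Z_matrix M -> mx_le 0 (M *m (const_mx 1 : 'cV[R]_n)) -> - M i i <= M i j.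
Proof.
move=> ZM /(_ i 0); rewrite !mxE; under eq_bigr do rewrite mxE mulr1.
rewrite (bigD1 i) //= => Mi.
have off_le0 (P : pred 'I_n) : \sum_(c | (c != i) && P c) M i c <= 0.
  by apply: sumr_le0 => c /andP[ci _]; rewrite ZM // eq_sym.
have [<-|ij] := eqVneq i j.
  by have := off_le0 xpredT; under eq_bigl do rewrite andbT; lra.
move: Mi; rewrite (bigD1 j) 1?eq_sym //=.
by have := off_le0 (fun c => c != j); lra.
Qed.

Lemma unitmx_colP {n : nat} (M : 'M[R]_n) :
  (forall x : 'cV[R]_n, M *m x = 0 -> x = 0) -> M \in unitmx.
Proof.
move=> Mx; rewrite -unitmx_tr -row_free_unit -kermx_eq0.
apply/eqP/row_matrixP => i; rewrite row0.
apply: trmx_inj; rewrite trmx0; apply: Mx.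
by rewrite -[M in M *m _]trmxK -trmx_mul -row_mul mulmx_ker row0 trmx0.
Qed.

End ZMatrices.

(** * The Dirichlet problem on a strip *)

Section Dirichlet.
Context {R : realType} {n : nat}.
Implicit Types (A B C : 'M[R]_n) (h g : int -> 'cV[R]_n) (N : int).

(** The kernel of the truncation of the bi-infinite matrix to the block rows
    and columns [1, ..., N - 1]: its vectors are extended by zero, so that the
    equations at the two ends need no special form. *)
Definition dirichlet A B C N h : Prop :=
  (forall j, ~~ (0 < j < N) -> h j = 0) /\
  (forall j, 0 < j < N -> B *m h j = A *m h (j - 1) + C *m h (j + 1)).

Lemma dirichletN A B C N h :
  dirichlet A B C N h -> dirichlet A B C N (fun j => - h j).
Proof.
move=> [h0 hE]; split=> j jN; first by rewrite h0 // oppr0.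
by rewrite !mulmxN hE // opprD.
Qed.

(** The bi-infinite matrix has nonnegative entries off the diagonal and zero
    row sums, so that on a row inside the strip [M - h] averages to zero over
    the neighbours with positive weights, and has to vanish at each of them.
    Outside the strip there is nothing to show, since there [h = 0 < M]. *)
Lemma dirichlet_max_edge A B C N h (M : R) :
  mx_le 0 A -> mx_le 0 C -> Z_matrix B ->
  (A - B + C) *m (const_mx 1 : 'cV[R]_n) = 0 ->
  dirichlet A B C N h -> 0 < M -> (forall j a, h j a 0 <= M) ->
  forall x y, nonzero_graph (bi_infinite A B C) x y ->
    h x.1 x.2 0 = M -> h y.1 y.2 0 = M.
Proof.
move=> A0 C0 ZB S1 [h0 hE] M0 hM [j a] [j' b] /= e hjM.
have jN : 0 < j < N.
  by apply/negPn/negP => /h0 hj0; move: M0; rewrite -hjM hj0 mxE ltxx.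
pose T i c := M - h i c 0.
have T0 i c : 0 <= T i c by rewrite subr_ge0.
have A0' c d : 0 <= A c d by have := A0 c d; rewrite mxE.
have C0' c d : 0 <= C c d by have := C0 c d; rewrite mxE.
pose f c := A a c * T (j - 1) c + C a c * T (j + 1) c - B a c * T j c.
have BT c : 0 <= - (B a c * T j c).
  have [<-|ac] := eqVneq a c; first by rewrite /T hjM subrr mulr0 oppr0.
  by rewrite -mulNr mulr_ge0 // oppr_ge0 ZB.
have AT c : 0 <= A a c * T (j - 1) c by rewrite mulr_ge0.
have CT c : 0 <= C a c * T (j + 1) c by rewrite mulr_ge0.
have f0 c : true -> 0 <= f c by move=> _; rewrite /f !addr_ge0.
have fs : \sum_c f c = 0.
  have := congr1 (fun z : 'cV_n => z a 0) S1; rewrite !mxE => r1.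
  have := congr1 (fun z : 'cV_n => z a 0) (hE j jN); rewrite !mxE => r2.
  (* [M] times the row sum plus the residual of the equation, both zero *)
  transitivity (M * (\sum_c (A - B + C) a c * (const_mx 1 : 'cV[R]_n) c 0) +
    (\sum_c B a c * h j c 0 - (\sum_c A a c * h (j - 1) c 0 +
       \sum_c C a c * h (j + 1) c 0))); last by rewrite r1 r2 subrr mulr0 addr0.
  rewrite mulr_sumr -big_split /= -sumrB -big_split /=.
  by apply: eq_bigr => c _; rewrite !mxE /f /T; ring.
have fb : f b = 0 by apply: (psumr_eq0P f0 fs).
have [ATb CTb BTb] : [/\ A a b * T (j - 1) b = 0, C a b * T (j + 1) b = 0 &
    B a b * T j b = 0].
  by have := AT b; have := CT b; have := BT b; move: fb; rewrite /f; split; lra.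
suff /eqP : T j' b = 0 by rewrite subr_eq0 => /eqP.
move: e; rewrite /nonzero_graph /bi_infinite /=.
have [->|_] := eqVneq j' j.
  rewrite oppr_eq0 => Bab; move/eqP: BTb.
  by rewrite mulf_eq0 (negbTE Bab) => /eqP.
have [->|_] := eqVneq j' (j + 1).
  by move=> Cab; move/eqP: CTb; rewrite mulf_eq0 (negbTE Cab) => /eqP.
have [->|_] := eqVneq j' (j - 1); last by rewrite eqxx.
by move=> Aab; move/eqP: ATb; rewrite mulf_eq0 (negbTE Aab) => /eqP.
Qed.

(** The maximum principle: a positive maximum would spread along the edges of
    the graph, and so reach level [0], where [h] vanishes. *)
Lemma dirichlet_le0 A B C N h :
  mx_le 0 A -> mx_le 0 C -> Z_matrix B ->
  (A - B + C) *m (const_mx 1 : 'cV[R]_n) = 0 ->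
  irreducible_graph (nonzero_graph (bi_infinite A B C)) ->
  dirichlet A B C N h -> forall j a, h j a 0 <= 0.
Proof.
move=> A0 C0 ZB S1 irr dh j0 a0; have [h0 _] := dh.
rewrite leNgt; apply/negP => hpos.
have inside j a : 0 < h j a 0 -> 0 < j < N.
  by move=> hj; apply/negPn/negP => /h0 hj0; move: hj; rewrite hj0 mxE ltxx.
have j0N := inside _ _ hpos.
have jlt j : 0 < j < N -> (`|j| < `|N|)%N by lia.
(* Only the finitely many levels inside the strip matter for the maximum. *)
pose F (p : 'I_`|N| * 'I_n) := h p.1%:Z p.2 0.
case: (arg_maxP F (erefl : xpredT (Ordinal (jlt _ j0N), a0))) => p _ pmax.
have leF j a : 0 < j < N -> h j a 0 <= F p.
  move=> jN; have := pmax (Ordinal (jlt _ jN), a) isT.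
  by rewrite /F /= gez0_abs //; lia.
have M0 : 0 < F p by rewrite (lt_le_trans hpos) ?leF.
have hM j a : h j a 0 <= F p.
  have [jN|/h0 ->] := boolP (0 < j < N); first exact: leF.
  by rewrite mxE ltW.
have [w [ew lw]] := irr (p.1%:Z, p.2) (0, p.2).
suff : h 0 p.2 0 = F p by move=> hF; move: M0; rewrite -hF h0 ?mxE ?ltxx.
have : h (last (p.1%:Z, p.2) w).1 (last (p.1%:Z, p.2) w).2 0 = F p.
  have : h (p.1%:Z, p.2).1 (p.1%:Z, p.2).2 0 = F p by [].
  elim: w (p.1%:Z, p.2) ew {lw} => //= y w IHw x /andP[xy yw] hx.
  exact/(IHw _ yw)/(dirichlet_max_edge _ _ _ _ _ _ A0 C0 ZB S1 dh M0 hM _ _ xy).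
by rewrite lw.
Qed.

Lemma dirichlet_eq0 A B C N h :
  mx_le 0 A -> mx_le 0 C -> Z_matrix B ->
  (A - B + C) *m (const_mx 1 : 'cV[R]_n) = 0 ->
  irreducible_graph (nonzero_graph (bi_infinite A B C)) ->
  dirichlet A B C N h -> forall j, h j = 0.
Proof.
move=> A0 C0 ZB S1 irr dh j; apply/colP => a; rewrite mxE; apply/eqP.
rewrite eq_le (dirichlet_le0 _ _ _ _ _ A0 C0 ZB S1 irr dh) /= -oppr_le0.
have := dirichlet_le0 _ _ _ _ _ A0 C0 ZB S1 irr (dirichletN _ _ _ _ _ dh) j a.
by rewrite mxE.
Qed.

(** One step of Cyclic Reduction is the elimination of the odd block rows:
    placing [g] at the even levels and solving the equations at the odd levels
    turns the equations of the reduced system into those at the even levels. *)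
Lemma dirichlet_refine A B C N g :
  B \in unitmx ->
  dirichlet (A *m invmx B *m A)
    (B - A *m invmx B *m C - C *m invmx B *m A) (C *m invmx B *m C) N g ->
  exists2 h, dirichlet A B C (2 * N) h & forall j, h (2 * j) = g j.
Proof.
move=> uB [g0 gE].
pose o j := invmx B *m (A *m g j + C *m g (j + 1)).
pose h m := if (2 %| m)%Z then g (m %/ 2)%Z else o (m %/ 2)%Z.
have he j : h (2 * j) = g j.
  rewrite /h; have -> : (2 %| 2 * j)%Z by lia.
  by congr g; lia.
have ho j : h (2 * j + 1) = o j.
  rewrite /h; have -> : (2 %| 2 * j + 1)%Z = false by lia.
  by congr o; lia.
exists h => //; split => m mN.
  have [j [mE|mE]] : exists j, m = 2 * j \/ m = 2 * j + 1.
  - by exists (m %/ 2)%Z; lia.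
  - by rewrite mE he g0 //; lia.
  rewrite mE ho /o g0; last by lia.
  rewrite g0; last by lia.
  by rewrite !mulmx0 addr0 mulmx0.
have [j [mE|mE]] : exists j, m = 2 * j \/ m = 2 * j + 1.
- by exists (m %/ 2)%Z; lia.
- rewrite mE he; have -> : 2 * j - 1 = 2 * (j - 1) + 1 by lia.
  rewrite !ho /o subrK.
  have /gE : 0 < j < N by lia.
  rewrite !(mulmxDr, mulmxBl) -!mulmxA => H.
  by apply/eqP; rewrite -subr_eq0; move/eqP: H; rewrite -subr_eq0;
    congr (_ == _); apply/matrixP => a b; rewrite !mxE; ring.
- rewrite mE ho addrK; have -> : 2 * j + 1 + 1 = 2 * (j + 1) by lia.
  by rewrite !he mulKVmx.
Qed.

End Dirichlet.

(** * Invariants of Cyclic Reduction *)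

Section Invariants.
Context {R : realType} {n : nat} {A B C : 'M[R]_n}.

Let A_ k := cr_A (cyclic_reduction A B C k).
Let B_ k := cr_B (cyclic_reduction A B C k).
Let C_ k := cr_C (cyclic_reduction A B C k).
Let Bhat_ k := cr_Bhat (cyclic_reduction A B C k).

Lemma cr_AS k : A_ k.+1 = A_ k *m invmx (B_ k) *m A_ k.
Proof. by rewrite /A_ /B_ /=; case: (cyclic_reduction _ _ _ _). Qed.

Lemma cr_BS k : B_ k.+1 = B_ k - A_ k *m invmx (B_ k) *m C_ k
                               - C_ k *m invmx (B_ k) *m A_ k.
Proof. by rewrite /A_ /B_ /C_ /=; case: (cyclic_reduction _ _ _ _). Qed.

Lemma cr_CS k : C_ k.+1 = C_ k *m invmx (B_ k) *m C_ k.
Proof. by rewrite /B_ /C_ /=; case: (cyclic_reduction _ _ _ _). Qed.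

Lemma cr_BhatS k : Bhat_ k.+1 = Bhat_ k - C_ k *m invmx (B_ k) *m A_ k.
Proof.
by rewrite /A_ /B_ /C_ /Bhat_ /=; case: (cyclic_reduction _ _ _ _).
Qed.

Lemma dirichlet_unroll k N g :
  (forall i, (i < k)%N -> B_ i \in unitmx) ->
  dirichlet (A_ k) (B_ k) (C_ k) N g ->
  exists2 h, dirichlet A B C (2 ^+ k * N) h & forall j, h (2 ^+ k * j) = g j.
Proof.
elim: k N g => [|k IHk] N g uB dg.
  by exists g => [|j]; rewrite mul1r.
move: dg; rewrite cr_AS cr_BS cr_CS => /dirichlet_refine [].
  exact: uB.
move=> h dh hg; have [i ik|h' dh' hh'] := IHk _ _ _ dh; first exact/uB/ltnW.
by exists h' => [|j]; rewrite exprSr -mulrA // hh' hg.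
Qed.

(** A kernel vector of [B_ k], put at level [1] of a strip with two levels,
    solves the Dirichlet problem of the reduced system. It unrolls to a
    solution for the original system on the strip [0 < j < 2 ^ (k + 1)], which
    has to be zero. *)
Lemma cr_B_unit k :
  mx_le 0 A -> mx_le 0 C -> Z_matrix B ->
  (A - B + C) *m (const_mx 1 : 'cV[R]_n) = 0 ->
  irreducible_graph (nonzero_graph (bi_infinite A B C)) ->
  B_ k \in unitmx.
Proof.
move=> A0 C0 ZB S1 irr; elim/ltn_ind: k => k IHk.
apply: unitmx_colP => x Bx.
pose g (j : int) := if j == 1 then x else 0.
have dg : dirichlet (A_ k) (B_ k) (C_ k) 2 g.
  split=> j jN; first by rewrite /g (_ : (j == 1) = false) //; lia.
  have -> : j = 1 by lia.
  have -> : g 1 = x by rewrite /g eqxx.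
  by rewrite Bx [g (1 - 1)]/= [g (1 + 1)]/= !mulmx0 addr0.
have [h dh hg] := dirichlet_unroll _ _ _ IHk dg.
by have := hg 1; rewrite (dirichlet_eq0 _ _ _ _ _ A0 C0 ZB S1 irr dh).
Qed.

(** Each step preserves a common right kernel vector of [A_ k - B_ k + C_ k],
    because [A' - B' + C' = (A + C) B^-1 (A + C) - B] and [(A + C) v = B v];
    the next three lemmas rest on the same cancellation. *)
Lemma cr_ker_right (v : 'cV[R]_n) k :
  (forall i, B_ i \in unitmx) -> (A - B + C) *m v = 0 ->
  (A_ k - B_ k + C_ k) *m v = 0.
Proof.
move=> uB Sv; elim: k => [//|k]; rewrite cr_AS cr_BS cr_CS.
move: (A_ k) (B_ k) (C_ k) (uB k) => a b c ub S0.
have E : (a + c) *m v = b *m v.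
  by apply/eqP; rewrite -subr_eq0 -mulmxBl addrAC S0.
have : (a + c) *m (invmx b *m ((a + c) *m v)) - b *m v = 0.
  by rewrite E mulKmx // E subrr.
rewrite !(mulmxDr, mulmxDl, mulmxN, mulNmx) -!mulmxA => <-.
by apply/matrixP => i j; rewrite !mxE; ring.
Qed.

Lemma cr_ker_left (u : 'rV[R]_n) k :
  (forall i, B_ i \in unitmx) -> u *m (A - B + C) = 0 ->
  u *m (A_ k - B_ k + C_ k) = 0.
Proof.
move=> uB Su; elim: k => [//|k]; rewrite cr_AS cr_BS cr_CS.
move: (A_ k) (B_ k) (C_ k) (uB k) => a b c ub S0.
have E : u *m (a + c) = u *m b.
  by apply/eqP; rewrite -subr_eq0 -mulmxBr addrAC S0.
have : u *m (a + c) *m invmx b *m (a + c) - u *m b = 0.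
  by rewrite E mulmxK // E subrr.
rewrite !(mulmxDr, mulmxDl, mulmxN, mulNmx) !mulmxA => <-.
by apply/matrixP => i j; rewrite !mxE; ring.
Qed.

Lemma cr_hat_ker_right (v : 'cV[R]_n) k :
  (forall i, B_ i \in unitmx) -> (A - B + C) *m v = 0 ->
  (A - Bhat_ k + C_ k) *m v = 0.
Proof.
move=> uB Sv; elim: k => [//|k]; rewrite cr_BhatS cr_CS.
move: (cr_ker_right v k uB Sv).
move: (A_ k) (B_ k) (C_ k) (Bhat_ k) (uB k) => a b c bh ub S1 S0.
have E : (a + c) *m v = b *m v.
  by apply/eqP; rewrite -subr_eq0 -mulmxBl addrAC S1.
have : c *m (invmx b *m ((a + c) *m v)) - c *m v = 0.
  by rewrite E mulKmx // subrr.
move=> E0; rewrite -[RHS]S0; apply/subr0_eq; rewrite -[RHS]E0.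
rewrite !(mulmxDr, mulmxDl, mulmxN, mulNmx) -!mulmxA.
by apply/matrixP => i j; rewrite !mxE; ring.
Qed.

Lemma cr_hat_ker_left (u : 'rV[R]_n) k :
  (forall i, B_ i \in unitmx) -> u *m (A - B + C) = 0 ->
  u *m (A_ k - Bhat_ k + C) = 0.
Proof.
move=> uB Su; elim: k => [//|k]; rewrite cr_BhatS cr_AS.
move: (cr_ker_left u k uB Su).
move: (A_ k) (B_ k) (C_ k) (Bhat_ k) (uB k) => a b c bh ub S1 S0.
have E : u *m (a + c) = u *m b.
  by apply/eqP; rewrite -subr_eq0 -mulmxBr addrAC S1.
have : u *m (a + c) *m invmx b *m a - u *m a = 0.
  by rewrite E mulmxK // subrr.
move=> E0; rewrite -[RHS]S0; apply/subr0_eq; rewrite -[RHS]E0.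
rewrite !(mulmxDr, mulmxDl, mulmxN, mulNmx) !mulmxA.
by apply/matrixP => i j; rewrite !mxE; ring.
Qed.

(** [B_ k] is a Z-matrix with row sums [(A_ k + C_ k) 1 >= 0], so its inverse
    is nonnegative, and the corrections of the next step have the right sign. *)
Lemma cr_signs :
  (forall i, B_ i \in unitmx) ->
  mx_le 0 A -> mx_le 0 C -> Z_matrix B ->
  (A - B + C) *m (const_mx 1 : 'cV[R]_n) = 0 ->
  forall k, [/\ mx_le 0 (A_ k), mx_le 0 (C_ k), Z_matrix (B_ k) &
    mx_le 0 (invmx (B_ k))].
Proof.
move=> uB A0 C0 ZB S1.
have inv_ge0 k : mx_le 0 (A_ k) -> mx_le 0 (C_ k) -> Z_matrix (B_ k) ->
    mx_le 0 (invmx (B_ k)).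
  move=> Ak Ck Zk; apply: Z_matrix_invmx_ge0 => //.
  have -> : B_ k *m const_mx 1 = (A_ k + C_ k) *m (const_mx 1 : 'cV[R]_n).
    by apply/eqP; rewrite eq_sym -subr_eq0 -mulmxBl addrAC cr_ker_right.
  by apply/mulmx_ge0/const_mx_ge0/ler01; apply: addmx_ge0.
elim=> [|k [Ak Ck Zk Ik]]; first by split => //; apply: inv_ge0.
have XY (X Y : 'M[R]_n) : mx_le 0 X -> mx_le 0 Y ->
    mx_le 0 (X *m invmx (B_ k) *m Y).
  by move=> X0 Y0; apply: mulmx_ge0 => //; apply: mulmx_ge0.
have Ak1 : mx_le 0 (A_ k.+1) by rewrite cr_AS; apply: XY.
have Ck1 : mx_le 0 (C_ k.+1) by rewrite cr_CS; apply: XY.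
have Zk1 : Z_matrix (B_ k.+1).
  move=> i j ij; rewrite cr_BS; have := Zk i j ij.
  have := XY _ _ Ak Ck i j; have := XY _ _ Ck Ak i j.
  move: (_ *m C_ k) (_ *m A_ k) => P Q; rewrite !mxE; lra.
by split => //; apply: inv_ge0.
Qed.

End Invariants.

(** * Limits of matrices *)

Section Limits.
Context {R : realType} {m n : nat}.

Lemma cvg_mxP (X : nat -> 'M[R]_(m, n)) (L : 'M[R]_(m, n)) :
  (forall i j, (fun k => X k i j) @ \oo --> L i j) -> X @ \oo --> L.
Proof.
move=> XL P [Q LQ QP].
have XQ : \forall k \near \oo, forall i j, Q i j (X k i j).
  by apply: filter_forall => i; apply: filter_forall => j; exact: XL _ (LQ i j).
by near=> k; apply: QP; near: k.
Unshelve. all: by end_near. Qed.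

Lemma cvg_coord (X : nat -> 'M[R]_(m, n)) (L : 'M[R]_(m, n)) i j :
  X @ \oo --> L -> (fun k => X k i j) @ \oo --> L i j.
Proof.
move=> XL; apply: (cvg_comp X (fun M : 'M[R]_(m, n) => M i j) XL).
exact: coord_continuous.
Qed.

Lemma lim_mx_ge0 (X : nat -> 'M[R]_(m, n)) (L : 'M[R]_(m, n)) :
  X @ \oo --> L -> (forall k, mx_le 0 (X k)) -> mx_le 0 L.
Proof.
move=> XL X0 i j; rewrite mxE; have Lij := cvg_coord _ _ i j XL.
rewrite -(cvg_lim (@Rhausdorff R) Lij); apply: limr_ge.
  exact: cvgP Lij.
by near=> k; have := X0 k i j; rewrite mxE.
Unshelve. all: by end_near. Qed.

Lemma nonincreasing_mx_cvg (X : nat -> 'M[R]_(m, n)) (D : 'M[R]_(m, n)) :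
  (forall k, mx_le (X k.+1) (X k)) -> (forall k, mx_le D (X k)) ->
  cvg (X @ \oo).
Proof.
move=> dX DX; apply/cvg_ex.
exists (\matrix_(i, j) lim ((fun k => X k i j) @ \oo)).
apply: cvg_mxP => i j; rewrite mxE; apply: nonincreasing_is_cvgn.
  by apply/nonincreasing_seqP => k; exact: dX.
by exists (D i j) => _ [k _ <-]; exact: DX.
Qed.

End Limits.

Lemma lim_Z_matrix {R : realType} {n : nat} (X : nat -> 'M[R]_n) (L : 'M[R]_n) :
  X @ \oo --> L -> (forall k, Z_matrix (X k)) -> Z_matrix L.
Proof.
move=> XL ZX i j ij; have Lij := cvg_coord _ _ i j XL.
rewrite -(cvg_lim (@Rhausdorff R) Lij); apply: limr_le; first exact: cvgP Lij.
by near=> k; apply: ZX.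
Unshelve. all: by end_near. Qed.

Lemma cvg_mulmxl {R : realType} {m n p : nat} (M : 'M[R]_(m, n))
    (X : nat -> 'M[R]_(n, p)) (L : 'M[R]_(n, p)) :
  X @ \oo --> L -> (fun k => M *m X k) @ \oo --> M *m L.
Proof.
move=> XL; apply: cvg_mxP => i j; rewrite mxE.
under eq_fun do rewrite mxE.
apply: cvg_big => [|a _]; first exact: add_continuous.
by apply: cvgMl_tmp; exact: cvg_coord.
Qed.

Lemma cvg_mulmxr {R : realType} {m n p : nat} (M : 'M[R]_(n, p))
    (X : nat -> 'M[R]_(m, n)) (L : 'M[R]_(m, n)) :
  X @ \oo --> L -> (fun k => X k *m M) @ \oo --> L *m M.
Proof.
move=> XL; apply: cvg_mxP => i j; rewrite mxE.
under eq_fun do rewrite mxE.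
apply: cvg_big => [|a _]; first exact: add_continuous.
by apply: cvgMr_tmp; exact: cvg_coord.
Qed.

(** * Convergence of the hat iterates and triplet representations *)

(** The corrections subtracted from [Bhat_k] are nonnegative, so its entries
    decrease; they stay bounded below because [Bhat_k 1 = (A + C_k) 1 >= 0]. *)
Lemma cr_Bhat_cvg {R : realType} {n : nat} (A B C : 'M[R]_n) :
  (forall k, cr_B (cyclic_reduction A B C k) \in unitmx) ->
  mx_le 0 A -> mx_le 0 C -> Z_matrix B ->
  (A - B + C) *m (const_mx 1 : 'cV[R]_n) = 0 ->
  (forall k, Z_matrix (cr_Bhat (cyclic_reduction A B C k))) /\
  cvg ((fun k => cr_Bhat (cyclic_reduction A B C k)) @ \oo).
Proof.
move=> uB A0 C0 ZB S1; have signs := cr_signs uB A0 C0 ZB S1.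
set X := fun k => cr_Bhat _.
have dX k : mx_le (X k.+1) (X k).
  have [Ak Ck _ Ik] := signs k; rewrite /X cr_BhatS => i j.
  have := mulmx_ge0 _ _ (mulmx_ge0 _ _ Ck Ik) Ak i j.
  by move: (_ *m cr_A _) => P; rewrite !mxE; lra.
have X0 k : mx_le (X k) B.
  by elim: k => [//|k IHk] i j; apply: le_trans (dX k i j) (IHk i j).
have ZX k : Z_matrix (X k).
  by move=> i j ij; apply: le_trans (X0 k i j) (ZB i j ij).
split=> //.
apply: (nonincreasing_mx_cvg X (\matrix_(i, j) - B i i)) => // k i j.
have [_ Ck _ _] := signs k.
rewrite mxE (@le_trans _ _ (- X k i i)) // ?lerN2 ?X0 //.
apply: Z_matrix_lbound => //.
have -> : X k *m const_mx 1 =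
    (A + cr_C (cyclic_reduction A B C k)) *m (const_mx 1 : 'cV[R]_n).
  apply/eqP; rewrite eq_sym -subr_eq0 -mulmxBl addrAC.
  by rewrite cr_hat_ker_right.
by apply/mulmx_ge0/const_mx_ge0/ler01; apply: addmx_ge0.
Qed.

Theorem lemma7 (R : realType) (n : nat) (A B C : 'M[R]_n) (u : 'rV[R]_n)
    (A4 : [/\ mx_le 0 A, mx_le 0 C & M_matrix B])
    (A5 : (A - B + C) *m (const_mx 1 : 'cV[R]_n) = 0)
    (A6 : irreducible_graph (nonzero_graph (bi_infinite A B C)) /\
          aperiodic_graph (nonzero_graph (bi_infinite A B C)))
    (u_gt0 : mx_lt 0 u)
    (u_ker : u *m (A - B + C) = 0) :
  let A_ k := cr_A (cyclic_reduction A B C k) in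
  let B_ k := cr_B (cyclic_reduction A B C k) in
  let C_ k := cr_C (cyclic_reduction A B C k) in
  let Bhat_ k := cr_Bhat (cyclic_reduction A B C k) in
  let one : 'cV[R]_n := const_mx 1 in
  let Bhat_oo : 'M[R]_n := lim (Bhat_ @ \oo) in
  [/\ (forall k, (A_ 0%N - Bhat_ k + C_ k) *m one = 0) /\
      (exists what : 'cV[R]_n,
         (fun k => C_ k *m one) @ \oo --> what /\
         triplet_representation Bhat_oo
           (offdiag Bhat_oo) one (A_ 0%N *m one + what)),
      (forall k, u *m (A_ k - B_ k + C_ k) = 0) &
      (forall k, u *m (A_ k - Bhat_ k + C_ 0%N) = 0) /\
      (exists vhat : 'rV[R]_n,
         (fun k => u *m A_ k) @ \oo --> vhat /\
         triplet_representation Bhat_oo^T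
           (offdiag Bhat_oo^T) u^T (u *m C_ 0%N + vhat)^T)].
Proof.
move=> A_ B_ C_ Bhat_ one Bhat_oo; have [A0 C0 /M_matrix_Z_matrix ZB] := A4.
have [irr _] := A6.
have uB k : B_ k \in unitmx by apply: cr_B_unit.
have signs := cr_signs uB A0 C0 ZB A5.
have [ZX cvgX] := cr_Bhat_cvg A B C uB A0 C0 ZB A5.
have XL : Bhat_ @ \oo --> Bhat_oo by [].
have ZL : Z_matrix Bhat_oo := lim_Z_matrix _ _ XL ZX.
have one0 : mx_le 0 one by apply/const_mx_ge0/ler01.
have u0 : mx_le 0 u by move=> i j; apply/ltW/u_gt0.
have R1 k : (A - Bhat_ k + C_ k) *m one = 0 by apply: cr_hat_ker_right.
have L1 k : u *m (A_ k - Bhat_ k + C) = 0 by apply: cr_hat_ker_left.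
split; [split=> // | by move=> k; apply: cr_ker_left | split=> //].
- have CE : (fun k => C_ k *m one) = (fun k => Bhat_ k *m one - A *m one).
    apply/funext => k; apply/eqP; rewrite -subr_eq0 -(R1 k); apply/eqP.
    rewrite !(mulmxDl, mulNmx).
    by apply/matrixP => i j; rewrite !mxE; ring.
  have Cw : (fun k => C_ k *m one) @ \oo --> Bhat_oo *m one - A *m one.
    rewrite CE; apply: cvgB; last exact: cvg_cst.
    exact: cvg_mulmxr.
  exists (Bhat_oo *m one - A *m one); split=> //.
  apply: Z_matrix_triplet => //; last by rewrite addrC subrK.
    by move=> i j; rewrite !mxE.
  apply: addmx_ge0; first exact: mulmx_ge0.
  by apply: lim_mx_ge0 Cw _ => k; apply: mulmx_ge0 => //; have [] := signs k.
- have AE : (fun k => u *m A_ k) = (fun k => u *m Bhat_ k - u *m C).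
    apply/funext => k; apply/eqP; rewrite -subr_eq0 -(L1 k); apply/eqP.
    rewrite !(mulmxDr, mulmxN).
    by apply/matrixP => i j; rewrite !mxE; ring.
  have Av : (fun k => u *m A_ k) @ \oo --> u *m Bhat_oo - u *m C.
    rewrite AE; apply: cvgB; last exact: cvg_cst.
    exact: cvg_mulmxl.
  exists (u *m Bhat_oo - u *m C); split=> //.
  apply: Z_matrix_triplet; first exact: Z_matrix_tr.
  + by move=> i j; have := u_gt0 j i; rewrite !mxE.
  + apply/trmx_ge0/addmx_ge0; first exact: mulmx_ge0.
    by apply: lim_mx_ge0 Av _ => k; apply: mulmx_ge0 => //; have [] := signs k.
  + by rewrite -trmx_mul addrC subrK.
Qed.
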